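(* Let $b\in\mathbb{R}$ be given and suppose that there is a regular inertia operator $A\in\mathcal{L}_{is}^{sym}(C^\infty(\mathbb{S}^1))$ such that the $b$-equation $$m_t=-(m_x u+b\,m\,u_x),\qquad m=u-u_{xx},$$ is the Euler equation on $\mathrm{Diff}^\infty(\mathbb{S}^1)$ with respect to $\rho_A$. Then $b=2$ and $A=\mathrm{id}-\partial_x^2$.
   Context: $\mathbb{S}^1=\mathbb{R}/2\pi\mathbb{Z}$ is the circle, and $C^\infty(\mathbb{S}^1)$ is the Fréchet space of real-valued smooth functions on $\mathbb{S}^1$; subscripts $x$ and $t$ denote derivatives. $\mathrm{Diff}^\infty(\mathbb{S}^1)$ is the Lie group of all smooth orientation-preserving diffeomorphisms of $\mathbb{S}^1$, whose Lie algebra (the smooth vector fields on $\mathbb{S}^1$) is identified with $C^\infty(\mathbb{S}^1)$ with bracket $[u,v]=u_xv-uv_x$; write $\mathrm{ad}_u v=[u,v]$. $\mathcal{L}_{is}^{sym}(C^\infty(\mathbb{S}^1))$ is the set of all continuous linear isomorphisms $A$ of $C^\infty(\mathbb{S}^1)$ onto itself that are symmetric with respect to the $L_2(\mathbb{S}^1)$ inner product, i.e. $\int_{\mathbb{S}^1}(Au)v\,dx=\int_{\mathbb{S}^1}u(Av)\,dx$ for all $u,v\in C^\infty(\mathbb{S}^1)$. Each such $A$ is called a regular inertia operator on $\mathrm{Diff}^\infty(\mathbb{S}^1)$. It induces the right-invariant metric $\rho_A$ on $\mathrm{Diff}^\infty(\mathbb{S}^1)$ whose value at the identity is $\rho_A(u,v)=\int_{\mathbb{S}^1}(Au)\,v\,dx$.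 Let $(\mathrm{ad}_u)^*$ be the adjoint of $\mathrm{ad}_u$ with respect to $\rho_A$, i.e. $\rho_A((\mathrm{ad}_u)^*v,w)=\rho_A(v,\mathrm{ad}_u w)$ for all $w\in C^\infty(\mathbb{S}^1)$, and let $B(u,v)=\frac12\big[(\mathrm{ad}_u)^*v+(\mathrm{ad}_v)^*u\big]$ be the Christoffel operator. The Euler equation on $\mathrm{Diff}^\infty(\mathbb{S}^1)$ with respect to $\rho_A$ is $u_t=-B(u,u)$; explicitly, $u_t=-A^{-1}\big(2(Au)u_x+u(Au)_x\big)$. With $L=\mathrm{id}-\partial_x^2$ (which is invertible on $C^\infty(\mathbb{S}^1)$), the $b$-equation reads $u_t=-L^{-1}\big(b(Lu)u_x+u(Lu)_x\big)$. Saying that the $b$-equation is the Euler equation with respect to $\rho_A$ means that these two evolution equations have the same right-hand side, i.e. $A^{-1}\big(2(Au)u_x+u(Au)_x\big)=L^{-1}\big(b(Lu)u_x+u(Lu)_x\big)$ for all $u\in C^\infty(\mathbb{S}^1)$.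
   Formalization: The conclusion A = id − ∂_x² is replaced by A = c(id − ∂_x²) for some real c ≠ 0, since the Euler equation is unchanged when A is multiplied by a nonzero constant (e.g. b = 2, A = 2(id − ∂_x²) satisfies all the hypotheses). *)

(* Defs.v *)
From HB Require Import structures.
From mathcomp Require Import all_boot all_order all_algebra.
From mathcomp Require Import all_classical all_reals all_analysis.

Set Implicit Arguments.
Unset Strict Implicit.
Unset Printing Implicit Defensive.
Import Order.TTheory GRing.Theory Num.Theory.
Import numFieldNormedType.Exports.
Local Open Scope ring_scope.
Local Open Scope classical_set_scope.

Definition smooth (R : realType) (f : R -> R) : Prop :=
  forall n x, derivable f^`(n) x 1.

Section SmoothTheory.
Variable R : realType.
Implicit Types f g : R -> R.

Let diffn n f := forall k x, (k <= n)%N -> derivable f^`(k) x 1.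

Let diffnS n f :
  (forall x, derivable f x 1) -> diffn n f^`() -> diffn n.+1 f.
Proof. by move=> df df' [|k] x // lekn; rewrite derive1Sn; exact: df'. Qed.

Let diffn_derive1 n f : diffn n.+1 f -> diffn n f^`().
Proof. by move=> df k x lekn; rewrite -derive1Sn; exact: df. Qed.

Let diffn_pred n f : diffn n.+1 f -> diffn n f.
Proof. by move=> df k x lekn; apply: df; exact: leqW. Qed.

Let diffn0 n f x : diffn n f -> derivable f x 1.
Proof. by move=> df; exact: (df 0%N). Qed.

Let diffnD n f g : diffn n f -> diffn n g -> diffn n (f \+ g).
Proof.
elim: n f g => [|n IH] f g df dg.
  by case=> // x _; apply: derivableD; [exact: diffn0 df|exact: diffn0 dg].
apply: diffnS => [x|].
  by apply: derivableD; [exact: diffn0 df|exact: diffn0 dg].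
rewrite (_ : derive1 _ = f^`() \+ g^`()).
  by apply: IH; [exact: diffn_derive1 df|exact: diffn_derive1 dg].
apply/funext => x; rewrite derive1E deriveD; first by rewrite /= !derive1E.
  exact: diffn0 df.
exact: diffn0 dg.
Qed.

Let diffnM n f g : diffn n f -> diffn n g -> diffn n (f \* g).
Proof.
elim: n f g => [|n IH] f g df dg.
  by case=> // x _; apply: derivableM; [exact: diffn0 df|exact: diffn0 dg].
apply: diffnS => [x|].
  by apply: derivableM; [exact: diffn0 df|exact: diffn0 dg].
rewrite (_ : derive1 _ = (f \* g^`()) \+ (g \* f^`())).
  apply: diffnD; apply: IH.
  - exact: diffn_pred df.
  - exact: diffn_derive1 dg.
  - exact: diffn_pred dg.
  - exact: diffn_derive1 df.
apply/funext => x; rewrite derive1E deriveM; first by rewrite /= !derive1E.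
  exact: diffn0 df.
exact: diffn0 dg.
Qed.

Let smoothP f : smooth f <-> forall n, diffn n f.
Proof. by split=> [sf n k x _|df n x]; [exact: sf|exact: (df n)]. Qed.

Lemma smooth_derivable f x : smooth f -> derivable f x 1.
Proof. by move=> /(_ 0%N x). Qed.

Lemma smooth_derive1 f : smooth f -> smooth f^`().
Proof. by move=> sf n x; rewrite -derive1Sn. Qed.

Lemma smooth_cst (c : R) : smooth (cst c).
Proof.
apply/smoothP => n; elim: n c => [|n IH] c.
  by case=> // x _; exact: derivable_cst.
apply: diffnS => [x|]; first exact: derivable_cst.
rewrite (_ : _^`() = cst 0); first exact: IH.
by apply/funext => x; exact: derive1_cst.
Qed.

Lemma smoothD f g : smooth f -> smooth g -> smooth (f \+ g).
Proof. by move=> /smoothP sf /smoothP sg; apply/smoothP => n; exact: diffnD. Qed.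

Lemma smoothM f g : smooth f -> smooth g -> smooth (f \* g).
Proof. by move=> /smoothP sf /smoothP sg; apply/smoothP => n; exact: diffnM. Qed.

End SmoothTheory.

(* A function on the circle R / 2 pi Z is a 2 pi-periodic function on R. *)
Definition smooth_periodic (R : realType) : {pred (R -> R)} :=
  fun f => `[< smooth f /\ forall x, f (x + 2 * pi) = f x >].
Arguments smooth_periodic : clear implicits.

Record circle_fun (R : realType) := CircleFun {
  circle_val :> R -> R;
  circle_valP : circle_val \in smooth_periodic R }.

HB.instance Definition _ (R : realType) := [isSub for @circle_val R].
HB.instance Definition _ (R : realType) := [Choice of circle_fun R by <:].

Section CircleAlgebra.
Variable R : realType.

Let sp_linear (c : R) f g : f \in smooth_periodic R ->
  g \in smooth_periodic R -> c *: f + g \in smooth_periodic R.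
Proof.
move=> /asboolP[sf pf] /asboolP[sg pg]; apply/asboolP; split.
  exact: smoothD (smoothM (@smooth_cst _ c) sf) sg.
by move=> x; rewrite !fctE pf pg.
Qed.

Let sp_cst (c : R) : cst c \in smooth_periodic R.
Proof. by apply/asboolP; split=> //; exact: (@smooth_cst _ c). Qed.

Lemma smooth_periodic_submod : GRing.submod_closed (smooth_periodic R).
Proof. by split; [exact: sp_cst|exact: sp_linear]. Qed.

Lemma smooth_periodic_subring : GRing.subring_closed (smooth_periodic R).
Proof.
split; first exact: sp_cst.
  by move=> f g hf hg; rewrite addrC -scaleN1r; exact: sp_linear.
move=> f g /asboolP[sf pf] /asboolP[sg pg]; apply/asboolP.
by split; [exact: smoothM|move=> x; rewrite !fctE pf pg].
Qed.

HB.instance Definition _ :=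
  GRing.SubChoice_isSubComNzRing.Build (R -> R) (smooth_periodic R)
    (circle_fun R) smooth_periodic_subring.
HB.instance Definition _ :=
  GRing.SubZmodule_isSubLmodule.Build R (R -> R) (smooth_periodic R)
    (circle_fun R) smooth_periodic_submod.

Lemma circle_derive_subproof (u : circle_fun R) :
  u^`() \in smooth_periodic R.
Proof.
have /asboolP[su pu] := circle_valP u.
apply/asboolP; split; first exact: smooth_derive1.
move=> x; rewrite /derive1 pu.
by under eq_fun do rewrite addrA pu.
Qed.

Definition circle_derive (u : circle_fun R) : circle_fun R :=
  CircleFun (circle_derive_subproof u).

(* The Frechet topology: u_i converges to u iff every derivative of u_i
   converges uniformly to the corresponding derivative of u. *)
Definition jets (u : circle_fun R) :
    prod_topology (fun _ : nat => {uniform R -> R}) :=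
  fun k => iter k circle_derive u : R -> R.

HB.instance Definition _ :=
  Uniform.copy (circle_fun R) (initial_topology jets).

Implicit Types u v w : circle_fun R.

Definition l2dot u v : R :=
  \int[lebesgue_measure]_(x in `[0, 2 * pi]) (u x * v x).

Lemma circle_continuous u : continuous u.
Proof.
have /asboolP[su _] := circle_valP u.
by move=> x; apply: differentiable_continuous; apply/derivable1_diffP; exact: (su 0%N).
Qed.

Lemma l2dotZl (c : R) u v : l2dot (c *: u) v = c * l2dot u v.
Proof.
rewrite /l2dot -RintegralZl//; last first.
  apply: continuous_compact_integrable; first exact: segment_compact.
  apply: continuous_subspaceT => x.
  by apply: cvgM; exact: circle_continuous.
by apply: eq_Rintegral => x _; rewrite mulrA.
Qed.

Definition ad u v := circle_derive u * v - u * circle_derive v.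

Section InertiaOperator.
Variable A : circle_fun R -> circle_fun R.

Definition regular_inertia :=
  [/\ bijective A, linear A, continuous A &
      forall u v, l2dot (A u) v = l2dot u (A v)].

Definition rho u v := l2dot (A u) v.

(* For a regular inertia operator exactly one z satisfies the defining
   identity, namely A^-1 (2 (A v) u_x + u (A v)_x), so that the default
   value 0 is irrelevant. *)
Definition ad_adjoint u v :=
  xget 0 [set z | forall w, rho z w = rho v (ad u w)].

Definition christoffel u v := 2^-1 *: (ad_adjoint u v + ad_adjoint v u).

Definition euler_field u := - christoffel u u.

End InertiaOperator.

(* Hence an inertia operator can be recovered from its Euler equation only up
   to a nonzero scalar factor. *)
Lemma euler_fieldZ (c : R) (A : circle_fun R -> circle_fun R) : c != 0 ->
  euler_field (fun u => c *: A u) = euler_field A.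
Proof.
move=> c0; have E u v : ad_adjoint (fun u => c *: A u) u v = ad_adjoint A u v.
  rewrite /ad_adjoint; congr (xget 0 _); apply/seteqP; split=> z h w.
    by apply: (mulfI c0); rewrite /rho -!l2dotZl; exact: h.
  by rewrite /rho !l2dotZl; congr (_ * _); exact: h.
by apply/funext => u; rewrite /euler_field /christoffel !E.
Qed.

Definition helmholtz u := u - circle_derive (circle_derive u).

(* helmholtz is a bijection, and this is its inverse. *)
Definition helmholtz_inv := 'pinv_(fun=> 0) [set: circle_fun R] helmholtz.

Definition b_field (b : R) u :=
  let m := helmholtz u in
  - helmholtz_inv (circle_derive m * u + b *: (m * circle_derive u)).

End CircleAlgebra.

(* Main.v *)
From HB Require Import structures.
Require Import Defs.
From mathcomp Require Import all_boot all_order all_algebra.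
From mathcomp Require Import all_classical all_reals all_analysis.
From mathcomp Require Import ring.

(** Write L for [helmholtz], d for the derivative and <u, v> for [l2dot u v].
    Adjunction turns the Euler field of A into - A^-1 (2 (A u) u' + u (A u)'),
    because (A u) (u' w - u w') differs from (2 (A u) u' + u (A u)') w by the
    derivative of a periodic function ([euler_fieldE]).  As L is a bijection,
    the hypothesis becomes an implication free of inverse operators:
      if L z = b (L u) u' + u (L u)' then A z = 2 (A u) u' + u (A u)'.   (E)
    The proof consists in testing (E) on well chosen u.

    - u = 1 and z = 0 give (A 1)' = 0, so A 1 is a constant c, nonzero because
      A is injective ([inertia_1]).
    - Pairing (E) with the constant 1 gives <A u, u'> = c <z, 1>, and
      <z, 1> = <L z, 1> = (b - 1) <L u, u'> = 0.  Polarising <A u, u'> = 0 and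
      using the symmetry of A shows that A commutes with d
      ([l2dot_inertia_derive], [inertia_derive]).
    - The difference of (E) at L w + 1 and at L w is linear in w; after
      commuting A with d it reads b A w' = 2 c L w'
      ([inertia_derive_helmholtz]).  Hence A is known on all derivatives.
    - sin, cos and sin cos are derivatives and eigenvectors of L, so both sides
      of (E) at u = cos are explicit multiples of sin cos; comparing them
      forces b = 2 ([inertia_parameter]).
    - With b = 2 the operator D = A - c L kills derivatives and commutes with
      d, so D u is a constant; it is orthogonal to the constants because
      D 1 = 0 and D is symmetric, hence D = 0 ([inertia_eq_helmholtz]).

    The analytic input is small: integration by parts over a period, the
    nondegeneracy of <., .> ([l2dot_eq0]), and the surjectivity of
    L = (1 - d) (1 + d), which follows from the periodic solvability of the
    first-order equations u' + k u = m ([circle_ode]). *)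

Set Implicit Arguments.
Unset Strict Implicit.
Unset Printing Implicit Defensive.
Import Order.TTheory GRing.Theory Num.Theory.
Import numFieldNormedType.Exports.
Local Open Scope ring_scope.

(** * Calculus on the circle *)

Section CircleCalculus.
Variable R : realType.
Implicit Types u v w m : circle_fun R.

Notation d := (@circle_derive R).

Lemma circle_funP u v : u =1 v -> u = v.
Proof. by move=> uv; apply/val_inj/funext. Qed.

Lemma circle_funD2pi u x : u (x + 2 * pi) = u x.
Proof. by have /asboolP[_] := circle_valP u. Qed.

Lemma circle_derivable u x : derivable u x 1.
Proof. by have /asboolP[/smooth_derivable] := circle_valP u. Qed.

Lemma is_derive_circle u x : is_derive x (1 : R) (u : R -> R) (d u x).
Proof. by split; [exact: circle_derivable|rewrite -derive1E]. Qed.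

Lemma circle_derive_val u x (df : R) :
  is_derive x (1 : R) (u : R -> R) df -> d u x = df.
Proof. by move=> uf; rewrite [LHS]derive1E; exact: derive_val. Qed.

Lemma circle_derive_linear : linear d.
Proof.
move=> c u v; apply: circle_funP => x.
have du := is_derive_circle u x; have dv := is_derive_circle v x.
exact: (@circle_derive_val (c *: u + v) x _ (is_deriveD (is_deriveZ c du) dv)).
Qed.

HB.instance Definition _ :=
  GRing.isLinear.Build R (circle_fun R) (circle_fun R) *:%R d
    circle_derive_linear.

Lemma circle_deriveZ (c : R) u : d (c *: u) = c *: d u.
Proof. exact: linearZ. Qed.

Lemma circle_deriveM u v : d (u * v) = d u * v + u * d v.
Proof.
apply: circle_funP => x.
have du := is_derive_circle u x; have dv := is_derive_circle v x.
rewrite (@circle_derive_val (u * v) x _ (is_deriveM du dv)).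
by rewrite addrC; congr (_ + _); exact: mulrC.
Qed.

Lemma circle_derive1 : d 1 = 0.
Proof.
apply: circle_funP => x.
by rewrite (@circle_derive_val 1 x 0)//; exact: (is_derive_cst (1 : R)).
Qed.

Lemma circle_derive_eq0 u :
  d u = 0 -> exists c : R, u = c *: (1 : circle_fun R).
Proof.
move=> du0; exists (u 0); apply: circle_funP => x.
rewrite -[RHS]/(u 0 * 1) mulr1; apply: is_derive_0_is_cst => y.
by have := is_derive_circle u y; rewrite du0.
Qed.

(** Routing scalars through the ring makes identities that mix scaling and
    multiplication accessible to the [ring] tactic, see [circle_scaleE]. *)
Definition circle_cst (c : R) : circle_fun R := c *: (1 : circle_fun R).

Lemma circle_scaleE (c : R) u : c *: u = circle_cst c * u.
Proof. by apply: circle_funP => x; rewrite -[RHS]/(c * 1 * u x) mulr1. Qed.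

(** * The L2 inner product *)

Lemma circle_integrable u (a b : R) :
  lebesgue_measure.-integrable `[a, b] (EFin \o u).
Proof.
apply: continuous_compact_integrable; first exact: segment_compact.
exact/continuous_subspaceT/circle_continuous.
Qed.

Lemma l2dotC u v : l2dot u v = l2dot v u.
Proof. by apply: eq_Rintegral => x _; rewrite mulrC. Qed.

Lemma l2dotE u v : l2dot u v = l2dot (u * v) 1.
Proof. by apply: eq_Rintegral => x _; rewrite mulr1. Qed.

Lemma l2dotDl u v w : l2dot (u + v) w = l2dot u w + l2dot v w.
Proof.
rewrite /l2dot -RintegralD//.
- by apply: eq_Rintegral => x _; rewrite -mulrDl.
- exact: (circle_integrable (u * w)).
- exact: (circle_integrable (v * w)).
Qed.

Lemma l2dotNl u w : l2dot (- u) w = - l2dot u w.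
Proof. by rewrite -scaleN1r l2dotZl mulN1r. Qed.

Lemma l2dotBl u v w : l2dot (u - v) w = l2dot u w - l2dot v w.
Proof. by rewrite l2dotDl l2dotNl. Qed.

Lemma l2dot0l w : l2dot 0 w = 0.
Proof. by rewrite -(scale0r 0) l2dotZl mul0r. Qed.

Lemma l2dotDr u v w : l2dot w (u + v) = l2dot w u + l2dot w v.
Proof. by rewrite l2dotC l2dotDl ![l2dot _ w]l2dotC. Qed.

Lemma l2dotZr c u w : l2dot w (c *: u) = c * l2dot w u.
Proof. by rewrite l2dotC l2dotZl l2dotC. Qed.

Lemma derivable_oo_LRcontinuous_circle u (a b : R) :
  derivable_oo_LRcontinuous u a b.
Proof.
split=> [x _||]; first exact: circle_derivable.
- exact/cvg_at_right_filter/circle_continuous.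
- exact/cvg_at_left_filter/circle_continuous.
Qed.

Lemma twopi_gt0 : 0 < 2 * pi :> R.
Proof. by rewrite mulr_gt0 ?pi_gt0. Qed.

Lemma l2dot_derive1 u : l2dot (d u) 1 = 0.
Proof.
rewrite /l2dot; under eq_Rintegral do rewrite mulr1.
rewrite /Rintegral (@continuous_FTC2 _ (d u) u) ?twopi_gt0//.
- by rewrite -EFinB /= -[2 * pi]add0r circle_funD2pi subrr.
- exact/continuous_subspaceT/circle_continuous.
- exact: derivable_oo_LRcontinuous_circle.
Qed.

Lemma l2dot_derive u v : l2dot (d u) v = - l2dot u (d v).
Proof.
apply/eqP; rewrite -addr_eq0 [l2dot u _]l2dotE l2dotE -l2dotDl.
by rewrite -circle_deriveM l2dot_derive1.
Qed.

Lemma circle_fundamental_domain u x : exists2 y, 0 <= y < 2 * pi & u x = u y.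
Proof.
pose k := Num.floor (x / (2 * pi)).
exists (x - k%:~R * (2 * pi)).
  have /andP[k1 k2] := floor_itv (x / (2 * pi)).
  rewrite subr_ge0 ltrBlDl -ler_pdivlMr ?twopi_gt0// k1 /=.
  rewrite -[X in _ < _ + X]mul1r -mulrDl -ltr_pdivrMr ?twopi_gt0//.
  by rewrite -[1]/(1%:~R) -intrD.
have per n z : u (z + n%:R * (2 * pi)) = u z.
  by rewrite mulr_natl; apply: (@periodicn _ _ u) => t; exact: circle_funD2pi.
case: k => n.
  by rewrite -[in LHS](subrK (n%:R * (2 * pi)) x) per pmulrn.
by rewrite NegzE mulrNz mulNr opprK per.
Qed.

Lemma l2dot_ge0 u : 0 <= l2dot u u.
Proof. by apply: Rintegral_ge0 => x _; exact: sqr_ge0. Qed.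

(** The primitive of u ^ 2 from 0 is nondecreasing and vanishes at both ends of
    the period, hence is constant there, so that its derivative u ^ 2 vanishes
    inside the period; continuity and periodicity reach the other points. *)
Lemma l2dot_eq0 u : l2dot u u = 0 -> u = 0.
Proof.
move=> I0.
pose g := u * u; pose G x : R := \int[lebesgue_measure]_(t in `[0, x]) g t.
have g_ge0 x : 0 <= g x by exact: sqr_ge0.
have G_le x y : 0 <= x -> x <= y -> G x <= G y.
  move=> x0 xy; rewrite -subr_ge0 /G.
  rewrite (@Rintegral_itvB _ g (BLeft 0) (BRight y)) ?bnd_simp//.
    by apply: Rintegral_ge0.
  exact: circle_integrable.
have G0 x : 0 <= x -> x <= 2 * pi -> G x = 0.
  move=> x0 xpi; apply/eqP; rewrite eq_le; apply/andP; split.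
    by rewrite -I0; apply: G_le.
  exact: Rintegral_ge0.
have g0 x : 0 < x < 2 * pi -> g x = 0.
  move=> /andP[x0 xpi].
  have [|_ <-] := @continuous_FTC1 _ g (BLeft 0) x (2 * pi) xpi
    (circle_integrable g 0 (2 * pi)) _ (@circle_continuous _ g x).
    by rewrite lte_fin.
  rewrite derive1E -[RHS](derive_cst (0 : R) x (1 : R)); apply: near_eq_derive.
  near=> y; apply: G0; apply/ltW; near: y; [exact: lt_nbhsr|exact: lt_nbhsl].
have u0 x : 0 < x < 2 * pi -> u x = 0.
  by move=> /g0 /eqP; rewrite [g x]/(u x * u x) mulf_eq0 orbb => /eqP.
apply: circle_funP => x; have [y /andP[]] := circle_fundamental_domain u x.
rewrite le_eqVlt => /predU1P[<- _ ->|y0 y1 ->]; last exact/u0/andP.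
(* The base point 0 is reached as a limit from the right. *)
have u0c : (u t @[t --> 0^'+] --> u 0)%classic.
  exact/cvg_at_right_filter/circle_continuous.
apply/esym; apply: cvg_unique u0c => //.
apply: cvg_near_cst; near=> t; apply: u0; apply/andP; split=> //.
by near: t; apply: nbhs_right_lt; exact: twopi_gt0.
Unshelve. all: by end_near. Qed.

Lemma l2dot_inj u v : (forall w, l2dot u w = l2dot v w) -> u = v.
Proof.
move=> uv; apply/eqP; rewrite -subr_eq0; apply/eqP/l2dot_eq0.
by rewrite l2dotBl uv subrr.
Qed.

(** * First-order periodic equations and the inverse of helmholtz *)

Lemma circle_bounded u : exists C, forall x, `|u x| <= C.
Proof.
have [|c _ uc] := @EVT_max _ (fun x => `|u x|) 0 (2 * pi) (ltW twopi_gt0).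
  apply: continuous_subspaceT => x.
  by apply: cvg_norm; exact: circle_continuous.
exists `|u c| => x; have [y /andP[y0 y1] ->] := circle_fundamental_domain u x.
by apply: uc; rewrite in_itv/= y0 ltW.
Qed.

Lemma is_derive_expRM (k x : R) :
  is_derive x 1 (fun t => expR (k * t)) (k * expR (k * x)).
Proof.
have lin : is_derive x 1 ( *%R k) k.
  by apply: is_derive_eq; rewrite scaler1.
apply: (is_derive_eq (is_derive1_comp (is_derive_expR _) lin)).
by rewrite mulrC.
Qed.

Lemma is_derive_circle_shift u (a x : R) :
  is_derive x 1 (fun t => u (a + t)) (d u (a + x)).
Proof.
have sh : is_derive x 1 ( +%R a) 1 by apply: is_derive_eq; rewrite add0r.
apply: (is_derive_eq (is_derive1_comp (is_derive_circle u _) sh)).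
by rewrite mulr1.
Qed.

(** Up to the factor 1 / (exp (2 pi k) - 1), this is the variation-of-constants
    formula for the periodic solution of v' + k v = u.  Integrating translates
    of u over a fixed interval makes periodicity evident and lets the derivative
    pass to u. *)
Definition exp_average k u x : R :=
  \int[lebesgue_measure]_(s in `[0, 2 * pi]) (expR (k * s) * u (x + s)).

Lemma continuous_expRM (k : R) : continuous (fun s : R => expR (k * s)).
Proof.
move=> s; apply: differentiable_continuous; apply/derivable1_diffP.
by have := is_derive_expRM k s.
Qed.

Lemma continuous_circle_shift u (a : R) : continuous (fun s : R => u (a + s)).
Proof.
move=> s; apply: differentiable_continuous; apply/derivable1_diffP.
by have := is_derive_circle_shift u a s.
Qed.

Lemma exp_average_integrable k u x :
  lebesgue_measure.-integrable `[0, 2 * pi]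
    (fun s => (expR (k * s) * u (x + s))%:E).
Proof.
apply: continuous_compact_integrable; first exact: segment_compact.
apply: continuous_subspaceT => s; apply: cvgM.
  exact: continuous_expRM.
exact: continuous_circle_shift.
Qed.

(** Differentiation under the integral sign, dominated by a bound for the
    periodic function u'. *)
Lemma is_derive_exp_average (k : R) u (x : R) :
  is_derive x 1 (exp_average k u) (exp_average k (d u) x).
Proof.
have [C duC] := circle_bounded (d u).
pose f (y s : R) := expR (k * s) * u (y + s).
have df (y s : R) : is_derive y 1 (f ^~ s) (expR (k * s) * d u (y + s)).
  have := is_derive_circle_shift u s y.
  under eq_fun do rewrite addrC.
  by rewrite addrC => /(is_deriveZ (expR (k * s))).
have d1f y s : partial1of2 f y s = expR (k * s) * d u (y + s).
  by rewrite /partial1of2 derive1E; apply: derive_val.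
have xI : (`]x - 1, x + 1[%classic : set R) x.
  by rewrite /= in_itv/= ltrBlDr ltrDl ltr01.
have G0 s : 0 <= expR (k * s) * C.
  by rewrite mulr_ge0 ?expR_ge0//; apply: le_trans (duC 0).
have intG : lebesgue_measure.-integrable `[0, 2 * pi]
    (EFin \o (fun s => expR (k * s) * C)).
  apply: continuous_compact_integrable; first exact: segment_compact.
  apply: continuous_subspaceT => s; apply: cvgM; last exact: cvg_cst.
  exact: continuous_expRM.
have intf y : `]x - 1, x + 1[%classic y ->
    lebesgue_measure.-integrable `[0, 2 * pi] (EFin \o f y).
  by move=> _; exact: exp_average_integrable.
have derf y s : `]x - 1, x + 1[%classic y -> `[0, 2 * pi]%classic s ->
  derivable (f ^~ s) y 1 by [].
have fG y s : `]x - 1, x + 1[%classic y -> `[0, 2 * pi]%classic s ->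
    `|partial1of2 f y s| <= expR (k * s) * C.
  by move=> _ _; rewrite d1f normrM ger0_norm ?expR_ge0// ler_pM2l ?expR_gt0.
split.
  exact: (derivable_under_integral (mu := lebesgue_measure)
    (measurable_itv `[0, 2 * pi]) xI intf derf G0 intG fG).
rewrite -derive1E.
rewrite (differentiation_under_integral (mu := lebesgue_measure)
    (measurable_itv `[0, 2 * pi]) xI intf derf G0 intG fG).
by apply: eq_Rintegral => s _; exact: d1f.
Qed.

Lemma exp_average_smooth_periodic k u : exp_average k u \in smooth_periodic R.
Proof.
apply/asboolP; split; last first.
  move=> x; apply: eq_Rintegral => s _.
  by rewrite addrAC circle_funD2pi.
move=> n.
have -> : ((exp_average k u)^`(n))%classic = exp_average k (iter n d u).
  elim: n => // n IH; rewrite derive1nS IH; apply/funext => x.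
  by rewrite derive1E; apply: derive_val; exact: is_derive_exp_average.
by move=> x; have := is_derive_exp_average k (iter n d u) x.
Qed.

(** Integration by parts; the boundary terms combine because u takes the same
    value at x and x + 2 pi. *)
Lemma exp_average_derive k u x :
  exp_average k (d u) x =
    (expR (k * (2 * pi)) - 1) * u x - k * exp_average k u x.
Proof.
rewrite /exp_average -RintegralZl//; last exact: exp_average_integrable.
rewrite (@Rintegration_by_parts _ (fun s => expR (k * s)) (fun s => u (x + s))
  (fun s => k * expR (k * s)) (fun s => d u (x + s))).
- rewrite circle_funD2pi mulr0 expR0 addr0 mulrBl.
  by congr (_ - _); apply: eq_Rintegral => s _; rewrite mulrA.
- exact: twopi_gt0.
- apply: continuous_subspaceT => s; apply: cvgM; first exact: cvg_cst.
  exact: continuous_expRM.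
- split=> [y _||].
  + by have := is_derive_expRM k y.
  + exact/cvg_at_right_filter/continuous_expRM.
  + exact/cvg_at_left_filter/continuous_expRM.
- by move=> y _; rewrite derive1E; apply: derive_val; exact: is_derive_expRM.
- exact/continuous_subspaceT/continuous_circle_shift.
- split=> [y _||].
  + by have := is_derive_circle_shift u x y.
  + exact/cvg_at_right_filter/continuous_circle_shift.
  + exact/cvg_at_left_filter/continuous_circle_shift.
- move=> y _; rewrite derive1E; apply: derive_val.
  exact: is_derive_circle_shift.
Qed.

(** For k = 0 a solution exists only if m has mean zero; for k <> 0 the factor
    exp (2 pi k) - 1 of [exp_average_derive] is invertible. *)
Lemma circle_ode k m : k != 0 -> exists u, d u + k *: u = m.
Proof.
move=> k0; pose K := (expR (k * (2 * pi)) - 1)^-1.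
have K0 : expR (k * (2 * pi)) - 1 != 0.
  rewrite subr_eq0 -[X in _ == X]expR0; apply: contra_neq k0 => /expR_inj kpi.
  by apply: (mulIf (lt0r_neq0 twopi_gt0)); rewrite mul0r.
pose v := CircleFun (exp_average_smooth_periodic k m).
have dvE x : d v x = exp_average k (d m) x.
  by rewrite (@circle_derive_val v x _ (is_derive_exp_average k m x)).
have vE x : v x = exp_average k m x by [].
move: v vE dvE => v vE dvE.
exists (K *: v); rewrite linearZ/= scalerA [k * K]mulrC -scalerA -scalerDr.
apply: circle_funP => x; transitivity (K * (d v x + k * v x)); first by [].
by rewrite dvE vE exp_average_derive subrK mulKf.
Qed.

(** The operator factors as (1 - d) (1 + d). *)
Lemma helmholtz_surj m : exists u, helmholtz u = m.
Proof.
have [v vm] : exists v, d v + (-1) *: v = - m.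
  by apply: circle_ode; rewrite oppr_eq0 oner_eq0.
have [u uv] := circle_ode v (oner_neq0 R).
exists u; rewrite -[RHS]opprK -vm -uv /helmholtz linearD/= !scale1r scaleN1r.
by ring.
Qed.

Lemma helmholtz_invK m : helmholtz (helmholtz_inv m) = m.
Proof.
by have [u um] := helmholtz_surj m; apply: pinvK; rewrite inE; exists u.
Qed.

Lemma helmholtz_linear : linear (@helmholtz R).
Proof.
move=> c u v; rewrite /helmholtz.
have -> : d (d (c *: u + v)) = c *: d (d u) + d (d v) by rewrite !linearP.
by rewrite scalerBr opprD addrACA.
Qed.

HB.instance Definition _ :=
  GRing.isLinear.Build R (circle_fun R) (circle_fun R) *:%R (@helmholtz R)
    helmholtz_linear.

Lemma helmholtzZ (c : R) u : helmholtz (c *: u) = c *: helmholtz u.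
Proof. exact: linearZ. Qed.

(** The quadratic form of the operator is <w, w> + <w', w'>. *)
Lemma helmholtz_inj : injective (@helmholtz R).
Proof.
move=> u v uv; apply/eqP; rewrite -subr_eq0; apply/eqP/l2dot_eq0.
set w := u - v.
have : l2dot (helmholtz w) w = 0 by rewrite linearB/= uv subrr l2dot0l.
rewrite l2dotBl l2dot_derive opprK => /eqP.
rewrite paddr_eq0; [|exact: l2dot_ge0..].
by move=> /andP[/eqP w0 _]; exact: w0.
Qed.

Lemma helmholtz1 : helmholtz 1 = 1 :> circle_fun R.
Proof. by rewrite /helmholtz circle_derive1 linear0 subr0. Qed.

Lemma helmholtz_derive u : helmholtz (d u) = d (helmholtz u).
Proof. by rewrite /helmholtz linearB. Qed.

(** * Trigonometric test functions *)

(** Derivation acts on this family by a rotation of the coefficients, which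
    gives smoothness of all its members by one induction. *)
Definition trig (a b x : R) : R := a * sin x + b * cos x.

Lemma is_derive_trig (a b x : R) : is_derive x 1 (trig a b) (trig (- b) a x).
Proof.
have ds := is_deriveZ a (is_derive_sin x).
have dc := is_deriveZ b (is_derive_cos x).
apply: (is_derive_eq (is_deriveD ds dc)).
by rewrite /trig addrC !mulNr -mulrN.
Qed.

Lemma trig_smooth_periodic (a b : R) : trig a b \in smooth_periodic R.
Proof.
apply/asboolP; split; last first.
  by move=> x; rewrite /trig mulr_natl sinD2pi cosD2pi.
move=> n; elim: n a b => [|n IH] a b x; first by have := is_derive_trig a b x.
have E : ((trig a b)^`())%classic = trig (- b) a.
  apply/funext => y; rewrite derive1E; apply: derive_val.
  exact: is_derive_trig.
by rewrite derive1Sn E.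
Qed.

Definition circle_sin := CircleFun (trig_smooth_periodic 1 0).
Definition circle_cos := CircleFun (trig_smooth_periodic 0 1).

Lemma circle_derive_sin : d circle_sin = circle_cos.
Proof.
apply: circle_funP => x.
rewrite (circle_derive_val (u := circle_sin) (is_derive_trig 1 0 x)).
by rewrite oppr0.
Qed.

Lemma circle_derive_cos : d circle_cos = - circle_sin.
Proof.
apply: circle_funP => x.
rewrite (circle_derive_val (u := circle_cos) (is_derive_trig 0 1 x)).
by rewrite -[RHS]/(- trig 1 0 x) /trig !mul0r !addr0 mulN1r mul1r.
Qed.

Lemma helmholtz_cos : helmholtz circle_cos = 2 *: circle_cos.
Proof.
rewrite /helmholtz circle_derive_cos linearN/= circle_derive_sin opprK.
by rewrite scaler_nat mulr2n.
Qed.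

Lemma helmholtz_sin : helmholtz circle_sin = 2 *: circle_sin.
Proof.
rewrite /helmholtz circle_derive_sin circle_derive_cos opprK.
by rewrite scaler_nat mulr2n.
Qed.

Lemma circle_derive_sin_sqr :
  d (circle_sin * circle_sin) = 2 *: (circle_sin * circle_cos).
Proof.
by rewrite circle_deriveM circle_derive_sin mulrC -mulr2n scaler_nat.
Qed.

Lemma helmholtz_sin_cos :
  helmholtz (circle_sin * circle_cos) = 5 *: (circle_sin * circle_cos).
Proof.
rewrite /helmholtz circle_deriveM circle_derive_sin circle_derive_cos mulrN.
rewrite linearB/= !circle_deriveM circle_derive_sin circle_derive_cos.
by rewrite scaler_nat; ring.
Qed.

Lemma circle_sin_cos_neq0 : circle_sin * circle_cos != 0.
Proof.
apply/eqP => sc0.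
have : d (circle_sin * circle_cos) 0 = 0 by rewrite sc0 linear0.
rewrite circle_deriveM circle_derive_sin circle_derive_cos.
rewrite -[LHS]/(circle_cos 0 * circle_cos 0 + circle_sin 0 * - circle_sin 0).
rewrite /= /trig sin0 cos0 !(mulr0, mulr1, add0r, addr0, oppr0).
by move/eqP; rewrite oner_eq0.
Qed.

(** * The two evolution equations in terms of momentum *)

Lemma l2dot1_eq f g h : f = g + d h -> l2dot f 1 = l2dot g 1.
Proof. by move=> ->; rewrite l2dotDl l2dot_derive1 addr0. Qed.

Lemma l2dot_derive_self u : l2dot u (d u) = 0.
Proof.
have /eqP := l2dot_derive u u.
by rewrite l2dotC -addr_eq0 -mulr2n mulrn_eq0 => /eqP.
Qed.

Lemma l2dot_helmholtz_derive u : l2dot (helmholtz u) (d u) = 0.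
Proof.
by rewrite l2dotBl l2dot_derive_self l2dotC l2dot_derive_self subrr.
Qed.

Lemma l2dot_helmholtz1 u : l2dot (helmholtz u) 1 = l2dot u 1.
Proof. by apply/esym/(l2dot1_eq (h := d u)); rewrite subrK. Qed.

(** Right-hand sides, up to sign, of the evolution equations of the momenta
    L u and A u: the fields of the two equations are their preimages under L and
    under A. *)
Definition b_momentum (b : R) u :=
  d (helmholtz u) * u + b *: (helmholtz u * d u).

Definition euler_momentum (A : circle_fun R -> circle_fun R) u :=
  2 * (A u * d u) + u * d (A u).

(** The adjoint of [ad u] for the plain L2 product; the two integrands differ by
    the derivative of m u w. *)
Lemma l2dot_ad m u w :
  l2dot m (ad u w) = l2dot (2 * (m * d u) + u * d m) w.
Proof.
rewrite l2dotE [RHS]l2dotE; apply/esym/(l2dot1_eq (h := (m * u * w))).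
by rewrite !circle_deriveM /ad; ring.
Qed.

(** Surjectivity of A provides an adjoint, so [xget] returns one, and the
    nondegeneracy of the L2 product identifies it. *)
Lemma euler_fieldE (A : circle_fun R -> circle_fun R) u : regular_inertia A ->
  A (- euler_field A u) = euler_momentum A u.
Proof.
move=> [[g _ gK] _ _ _].
have z_ex : exists z, forall w, rho A z w = rho A u (ad u w).
  by exists (g (euler_momentum A u)) => w; rewrite /rho gK l2dot_ad.
have zP := xgetPex 0 z_ex.
rewrite /euler_field /christoffel opprK; set z := ad_adjoint A u u.
have -> : 2^-1 *: (z + z) = z.
  by rewrite -(mulr2n z) -(scaler_nat 2 z) scalerA mulVf ?pnatr_eq0// scale1r.
by apply: l2dot_inj => w; rewrite -l2dot_ad; exact: zP.
Qed.

(** * Inertia operators of the b-equation *)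

Section EulerEquation.
Variables (b : R) (A : {linear circle_fun R -> circle_fun R}).
Hypothesis Asym : forall u v, l2dot (A u) v = l2dot u (A v).
Hypothesis Ainj : injective A.
Hypothesis bA : forall u z,
  helmholtz z = b_momentum b u -> A z = euler_momentum A u.

(** Constants are stationary for the b-equation. *)
Lemma inertia_1 : exists2 c : R, c != 0 & A 1 = c *: (1 : circle_fun R).
Proof.
have /bA : helmholtz 0 = b_momentum b 1.
  rewrite /b_momentum helmholtz1 circle_derive1.
  by rewrite !(mul0r, mulr0, scaler0, linear0) addr0.
rewrite linear0 /euler_momentum circle_derive1 !mulr0 add0r mul1r.
move=> /esym/circle_derive_eq0[c A1]; exists c => //.
apply/eqP => c0; move: A1; rewrite c0 scale0r -(linear0 A) => /Ainj/eqP.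
by rewrite oner_eq0.
Qed.

(** As A is symmetric and A 1 is constant, the mean of A z is a multiple of the
    mean of z, hence of that of L z; and [b_momentum] always has mean zero. *)
Lemma l2dot_inertia_derive u : l2dot (A u) (d u) = 0.
Proof.
have [c _ A1] := inertia_1.
have [z Lz] := helmholtz_surj (b_momentum b u).
have Iz : l2dot z 1 = 0.
  rewrite -l2dot_helmholtz1 Lz /b_momentum l2dotDl l2dotZl -!l2dotE.
  by rewrite l2dot_derive l2dot_helmholtz_derive mulr0 oppr0 addr0.
have := Asym z 1; rewrite A1 l2dotZr Iz mulr0 (bA Lz) => <-.
rewrite l2dotE; apply/esym/(l2dot1_eq (h := (u * A u))).
by rewrite circle_deriveM /euler_momentum; ring.
Qed.

(** Polarisation of [l2dot_inertia_derive], a skew-symmetry statement for the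
    composite of d and A. *)
Lemma inertia_derive u : A (d u) = d (A u).
Proof.
apply: l2dot_inj => w; rewrite Asym [RHS]l2dot_derive [LHS]l2dotC.
have : l2dot (A u + A w) (d u + d w) = 0.
  by rewrite -!linearD; exact: l2dot_inertia_derive.
rewrite l2dotDl !l2dotDr (l2dot_inertia_derive u) (l2dot_inertia_derive w).
move: (l2dot (A u) (d w)) (l2dot (A w) (d u)) => x y.
by rewrite add0r addr0 addrC => /eqP; rewrite addr_eq0 => /eqP.
Qed.

(** Both momenta are quadratic, so comparing u = L w + 1 with u = L w isolates
    their polarisation at (L w, 1).  On the side of the b-equation it equals
    L (L w' + b w'), which is why u is taken in the range of L. *)
Lemma inertia_derive_helmholtz (c : R) w : A 1 = c *: (1 : circle_fun R) ->
  b *: A (d w) = (2 * c) *: helmholtz (d w).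
Proof.
move=> A1; move: (helmholtz w) (helmholtz_derive w) => l dl.
have [z Lz] := helmholtz_surj (b_momentum b l).
have dl1 : d (l + 1) = d l by rewrite linearD/= circle_derive1 addr0.
have hZ : helmholtz (b *: d w) = b *: d l by rewrite linearZ/= dl.
have hD : helmholtz (l + 1) = helmholtz l + 1 by rewrite linearD/= helmholtz1.
have dhD : d (helmholtz l + 1) = d (helmholtz l).
  by rewrite linearD/= circle_derive1 addr0.
have /bA : helmholtz (z + d l + b *: d w) = b_momentum b (l + 1).
  rewrite 2!(linearD (@helmholtz R)) [LHS]/= hZ Lz helmholtz_derive.
  rewrite /b_momentum hD dl1 dhD !circle_scaleE.
  by ring.
have AD : A (l + 1) = A l + c *: (1 : circle_fun R) by rewrite linearD A1.
have dAD : d (A (l + 1)) = d (A l).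
  by rewrite AD linearD/= linearZ/= circle_derive1 scaler0 addr0.
have AZ : A (b *: d w) = b *: A (d w) by rewrite linearZ.
rewrite 2!(linearD A) (bA Lz) AZ /euler_momentum dl1 dAD AD inertia_derive.
move=> Azl; apply: (addrI (2 * (A l * d l) + l * d (A l) + d (A l))).
rewrite {}Azl dl -scalerA scaler_nat -mulr_natl !circle_scaleE.
by ring.
Qed.

(** The functions sin, cos and sin cos, the last one being half the derivative
    of sin ^ 2, are derivatives and eigenvectors of L, so b A acts on them by
    known factors; both momenta at u = cos are multiples of sin cos. *)
Lemma inertia_parameter : b = 2.
Proof.
have [c c0 /inertia_derive_helmholtz Ad] := inertia_1.
have AZ (k : R) v : A (k *: v) = k *: A v by rewrite linearZ.
set p := circle_sin * circle_cos.
have Acos : b *: A circle_cos = (4 * c) *: circle_cos.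
  have := Ad circle_sin; rewrite circle_derive_sin helmholtz_cos scalerA => ->.
  by congr (_ *: _); ring.
have Asin : b *: A circle_sin = (4 * c) *: circle_sin.
  have := Ad (- circle_cos).
  rewrite linearN/= circle_derive_cos opprK helmholtz_sin scalerA => ->.
  by congr (_ *: _); ring.
have Ap : b *: A p = (10 * c) *: p.
  have := Ad (circle_sin * circle_sin); rewrite circle_derive_sin_sqr -/p.
  rewrite AZ helmholtzZ helmholtz_sin_cos -/p !scalerA [b * 2]mulrC => Ap.
  apply: (@scalerI _ _ 2); first by rewrite pnatr_eq0.
  by rewrite !scalerA Ap; congr (_ *: _); ring.
(* The momentum of cos is - 2 (1 + b) p, and L p = 5 p. *)
have /bA Az : helmholtz ((- (2 * (1 + b) / 5)) *: p) = b_momentum b circle_cos.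
  rewrite helmholtzZ helmholtz_sin_cos scalerA /b_momentum helmholtz_cos.
  rewrite circle_deriveZ circle_derive_cos -/p.
  have -> : - (2 * (1 + b) / 5) * 5 = - 2 - 2 * b by field.
  rewrite scalerBl scaleNr -scalerA !scaler_nat /p !circle_scaleE.
  by ring.
have bAz : b *: A ((- (2 * (1 + b) / 5)) *: p) = (- (4 * (1 + b) * c)) *: p.
  rewrite AZ scalerA [b * _]mulrC -scalerA Ap scalerA.
  by congr (_ *: _); field.
have bAcos : b *: euler_momentum A circle_cos = (- (12 * c)) *: p.
  rewrite /euler_momentum -inertia_derive circle_derive_cos linearN/=.
  have -> : b *: (2 * (A circle_cos * - circle_sin) +
                  circle_cos * - A circle_sin) =
      - (2 * ((b *: A circle_cos) * circle_sin) +
         circle_cos * (b *: A circle_sin)).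
    by rewrite !circle_scaleE; ring.
  have -> : - (12 * c) = - (3 * (4 * c)) by ring.
  rewrite Acos Asin scaleNr -(scalerA 3) (scaler_nat 3) /p !circle_scaleE.
  by ring.
have /eqP : (12 * c - 4 * (1 + b) * c) *: p = 0.
  move: bAcos; rewrite -Az bAz !scaleNr => /oppr_inj pp.
  by rewrite scalerBl pp subrr.
rewrite scaler_eq0 (negbTE circle_sin_cos_neq0) orbF.
have -> : 12 * c - 4 * (1 + b) * c = 4 * c * (2 - b) by ring.
by rewrite !mulf_eq0 (negbTE c0) pnatr_eq0/= subr_eq0 eq_sym => /eqP.
Qed.

(** For b = 2 the operators A and c L agree on derivatives and commute with d,
    so their difference D takes constant values.  They are also symmetric and
    agree at 1, so D u is orthogonal to the constants, hence to itself. *)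
Lemma inertia_eq_helmholtz :
  exists2 c : R, c != 0 & forall u, A u = c *: helmholtz u.
Proof.
have [c c0 A1] := inertia_1; exists c => // u.
apply/eqP; rewrite -subr_eq0; apply/eqP/l2dot_eq0.
set D := A u - c *: helmholtz u.
have [e De] : exists e : R, D = e *: (1 : circle_fun R).
  apply: circle_derive_eq0; rewrite linearB/= circle_deriveZ -inertia_derive.
  apply/eqP; rewrite subr_eq0; apply/eqP; apply: (@scalerI _ _ 2).
    by rewrite pnatr_eq0.
  have := inertia_derive_helmholtz u A1.
  by rewrite inertia_parameter -scalerA helmholtz_derive.
rewrite {2}De l2dotZr l2dotBl Asym A1 l2dotZr l2dotZl l2dot_helmholtz1.
by rewrite subrr mulr0.
Qed.

End EulerEquation.

End CircleCalculus.

Theorem theorem5 (R : realType) (b : R) (A : circle_fun R -> circle_fun R) :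
  regular_inertia A ->
  (forall u : circle_fun R, b_field b u = euler_field A u) ->
  b = 2 /\ exists2 c : R, c != 0 & forall u, A u = c *: helmholtz u.
Proof.
move=> rA bE; have [Abij Alin _ Asym] := rA.
pose A' : {linear circle_fun R -> circle_fun R} :=
  HB.pack A (GRing.isLinear.Build R _ _ *:%R A Alin).
have bA u z : helmholtz z = b_momentum b u -> A' z = euler_momentum A' u.
  move=> Lz; rewrite -(euler_fieldE u rA) -bE /b_field opprK.
  by congr (A _); apply: helmholtz_inj; rewrite helmholtz_invK.
split; first exact: (inertia_parameter (A := A') Asym (bij_inj Abij) bA).
exact: (inertia_eq_helmholtz (A := A') Asym (bij_inj Abij) bA).
Qed.
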